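(* Let $k,s,t$ be positive integers with $t\geq 47$. Then $\operatorname{gr}_k(K_s,K_t)\leq 2^{kt}s^{3kt}$.
   Context: A $k$-edge-coloring of $K_n$ assigns to each edge one of $k$ colors (not all colors need be used, and it need not be proper). A subgraph is rainbow if all its edges have distinct colors, and monochromatic if all its edges have the same color. For graphs $G,H$ and a positive integer $k$, the Gallai-Ramsey number $\operatorname{gr}_k(G,H)$ is the minimum integer $n$ such that every $k$-edge-coloring of the complete graph $K_n$ contains a rainbow copy of $G$ or a monochromatic copy of $H$. *)

(* Defs.v *)
From mathcomp Require Import all_boot.

Set Implicit Arguments.
Unset Strict Implicit.
Unset Printing Implicit Defensive.

Record sgraph := SGraph {
  vertex :> finType;
  adj : rel vertex;
  adj_sym : symmetric adj;
  adj_irrefl : irreflexive adj }.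

Definition edges (G : sgraph) : {set {set G}} :=
  [set [set p.1; p.2] | p in [pred p : G * G | adj p.1 p.2]].

Lemma complete_sym n : symmetric [rel x y : 'I_n | x != y].
Proof. by move=> x y /=; rewrite eq_sym. Qed.

Lemma complete_irrefl n : irreflexive [rel x y : 'I_n | x != y].
Proof. by move=> x /=; rewrite eqxx. Qed.

Definition complete (n : nat) : sgraph :=
  SGraph (@complete_sym n) (@complete_irrefl n).

(* A colouring is a total function on vertex sets, but only its values on
   [edges F] are ever consulted; for k > 0 every function from [edges F] to
   'I_k extends to one of these. *)
Definition edge_coloring (k : nat) (F : sgraph) := {set F} -> 'I_k.

(* Copies are not required to be induced. *)
Definition is_copy (G F : sgraph) (f : G -> F) : Prop :=
  injective f /\ {homo f : x y / adj x y}.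

Definition copy_edges (G F : sgraph) (f : G -> F) : {set {set F}} :=
  [set f @: e | e : {set G} in edges G].

Definition has_rainbow_copy (k : nat) (F : sgraph) (c : edge_coloring k F)
    (G : sgraph) : Prop :=
  exists2 f : G -> F, is_copy f & {in copy_edges f &, injective c}.

Definition has_mono_copy (k : nat) (F : sgraph) (c : edge_coloring k F)
    (H : sgraph) : Prop :=
  exists2 f : H -> F, is_copy f &
    {in copy_edges f &, forall e1 e2, c e1 = c e2}.

Definition gallai_ramsey_prop (k : nat) (G H : sgraph) (n : nat) : Prop :=
  forall c : edge_coloring k (complete n),
    has_rainbow_copy c G \/ has_mono_copy c H.

(* gr_k(G,H) = n, as a relation: the minimum is attained at n.  Asserting
   [is_gr k G H n] therefore includes that such an n exists. *)
Definition is_gr (k : nat) (G H : sgraph) (n : nat) : Prop :=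
  gallai_ramsey_prop k G H n /\
  forall m : nat, gallai_ramsey_prop k G H m -> n <= m.

(* Main.v *)
(* Let A be a vertex set of size n >= 2 s^3 d.  If no vertex of A sends more than
   d edges of one colour into A, a rainbow K_s is built greedily: for a rainbow
   set U of size i < s, a new vertex is unusable if it lies in U, if it sends to
   U a colour already used inside U (at most i^3 d vertices), or if it sends the
   same colour to two vertices of U.  There are at most i^2 d of the last kind,
   because by double counting the next vertex can be chosen, among the at least
   n/2 usable ones, so that it creates at most 2 i d new ones.
   Otherwise some vertex has more than d neighbours in a single colour, and one
   descends into that neighbourhood as in the Erdos-Szekeres argument for
   Ramsey's theorem, losing a factor 2 s^3 each time; k t descents suffice. *)
Require Import Defs.
From mathcomp Require Import all_boot zify.
From Stdlib Require Import Classical.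

Set Implicit Arguments.
Unset Strict Implicit.
Unset Printing Implicit Defensive.

Section Coloring.

Variables (T C : finType) (c : {set T} -> C).
Implicit Types (A U : {set T}) (v x w : T) (a : C).

Definition pairs U : {set {set T}} :=
  [set e : {set T} | e \subset U & #|e| == 2].

Definition nbhd A x a := [set y in A | (y != x) && (c [set x; y] == a)].

Definition agree A v x :=
  [set w in A | [&& w != v, w != x & c [set w; v] == c [set w; x]]].

Definition clashing A U :=
  [set w in A | (w \notin U) &&
    [exists x in U, exists y in U, (x != y) && (c [set w; x] == c [set w; y])]].

(** Written as a union of at most |U| * |U|^2 colour neighbourhoods, so that a degree bound can be
    applied to each one. *)
Definition repeating A U :=
  \bigcup_(x in U) \bigcup_(a in c @: pairs U) nbhd A x a.

Lemma pairs_set2 U x y : x \in U -> y \in U -> x != y -> [set x; y] \in pairs U.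
Proof. by move=> Ux Uy xy; rewrite inE subUset !sub1set Ux Uy cards2 xy. Qed.

Lemma pairs_setU1 v U e : e \in pairs (v |: U) ->
  e \in pairs U \/ exists2 x, x \in U & e = [set v; x].
Proof.
rewrite inE => /andP[eU /cards2P[x [y [xy De]]]]; subst e; move: eU; rewrite subUset !sub1set !inE.
case/andP=> /orP[/eqP xv|Ux] /orP[/eqP yv|Uy].
- by rewrite xv yv eqxx in xy.
- by right; exists y; rewrite // xv.
- by right; exists x; rewrite // yv setUC.
- by left; have := pairs_set2 Ux Uy xy; rewrite inE.
Qed.

Lemma card_bigcup_le_sum (I : finType) (P : {set I}) (F : I -> {set T}) :
  #|\bigcup_(i in P) F i| <= \sum_(i in P) #|F i|.
Proof.
elim/big_rec2: _ => [|i n B _ IH]; first by rewrite cards0.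
by rewrite (leq_trans (leq_card_setU _ _)) // leq_add2l.
Qed.

Lemma card_bigcup_le (I : finType) (P : {set I}) (F : I -> {set T}) m :
  (forall i, i \in P -> #|F i| <= m) -> #|\bigcup_(i in P) F i| <= #|P| * m.
Proof.
move=> Fm; rewrite -sum_nat_const.
exact: leq_trans (card_bigcup_le_sum P F) (leq_sum _ Fm).
Qed.

Lemma card_pairs_le U : #|pairs U| <= #|U| ^ 2.
Proof. by rewrite cards_draws bin2; nia. Qed.

(** A clash that appears only once [v] is added must use the edge to [v], so the sets [agree A v x]
    control the growth. *)
Lemma clashing_setU1 A U v :
  clashing A (v |: U) \subset clashing A U :|: \bigcup_(x in U) agree A v x.
Proof.
apply/subsetP=> w; rewrite !inE negb_or => /andP[Aw /andP[/andP[wv wU]]].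
have agreeP z : z \in U -> c [set w; v] = c [set w; z] ->
    w \in \bigcup_(x in U) agree A v x.
  move=> Uz wz; apply/bigcupP; exists z; rewrite // inE Aw wv wz eqxx andbT /=.
  by apply: contraNneq wU => ->.
case/existsP=> x /andP[Ux /existsP[y /andP[Uy /andP[xy /eqP wxy]]]].
apply/orP; move: Ux Uy; rewrite !inE.
case/orP=> [/eqP xv|Ux] /orP[/eqP yv|Uy].
- by rewrite xv yv eqxx in xy.
- by right; apply: (agreeP y) => //; rewrite -xv.
- by right; apply: (agreeP x) => //; rewrite -yv.
- left; rewrite Aw wU /=; apply/existsP; exists x; rewrite Ux.
  by apply/existsP; exists y; rewrite Uy xy wxy /=.
Qed.

Section BoundedDegree.

Variables (A : {set T}) (d : nat).
Hypothesis degA : forall x a, x \in A -> #|nbhd A x a| <= d.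

Lemma card_repeating_le U : U \subset A -> #|repeating A U| <= #|U| ^ 3 * d.
Proof.
move=> /subsetP UA; rewrite expnS -mulnA; apply: card_bigcup_le => x Ux.
apply: leq_trans (leq_mul (card_pairs_le U) (leqnn d)).
apply: leq_trans (leq_mul (leq_imset_card c _) (leqnn d)).
by apply: card_bigcup_le => a _; apply: degA; apply: UA.
Qed.

(** Exchange the sums: for fixed [w], every [v] counted lies in the neighbourhood of [w] in colour
    [c [set w; x]], which has at most [d] elements. *)
Lemma sum_agree_le x : \sum_(v in A) #|agree A v x| <= #|A| * d.
Proof.
under eq_bigr => v _ do rewrite -sum1dep_card big_mkcondr.
rewrite exchange_big /= -sum_nat_const; apply: leq_sum => w Aw.
rewrite -big_mkcondr sum1dep_card.
apply: leq_trans (degA (c [set w; x]) Aw); apply: subset_leq_card.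
by apply/subsetP=> v; rewrite !inE => /and4P[-> + _ ->]; rewrite eq_sym => ->.
Qed.

Lemma rainbow_extend U : U \subset A -> {in pairs U &, injective c} ->
    #|clashing A U| <= #|U| ^ 2 * d -> 0 < d -> 2 * #|U|.+1 ^ 3 * d <= #|A| ->
  exists v, [/\ v \in A, v \notin U, {in pairs (v |: U) &, injective c}
    & #|clashing A (v |: U)| <= #|U|.+1 ^ 2 * d].
Proof.
move=> UA rbU clU d_gt0 leA; set i := #|U| in clU leA *.
pose G := A :\: (U :|: repeating A U :|: clashing A U).
have cardG : #|A| <= 2 * #|G| /\ 0 < #|G|.
  have: #|A| <= #|U :|: repeating A U :|: clashing A U| + #|G|.
    by rewrite -(cardsID (U :|: repeating A U :|: clashing A U) A) leq_add2r
               subset_leq_card ?subsetIr.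
  have [le1 _] := leq_card_setU (U :|: repeating A U) (clashing A U).
  have [le2 _] := leq_card_setU U (repeating A U).
  have le3 := card_repeating_le UA; rewrite -/i in le2 le3 => leAG.
  (* The three terms bound [U], [repeating A U] and [clashing A U]; by [leA] their union fills less
     than half of [A]. *)
  have: i + i ^ 3 * d + i ^ 2 * d < i.+1 ^ 3 * d by nia.
  rewrite -mulnA in leA.
  by split; lia.
case: cardG => cardG G_gt0.
have [v Gv agv] : exists2 v, v \in G &
    \sum_(x in U) #|agree A v x| <= 2 * i * d.
  (* Averaging: if every [v] in [G] exceeded the bound, summing over [G] and enlarging to [A] would
     contradict [sum_agree_le], because |A| <= 2 |G| and [G] is nonempty. *)
  apply/exists_inP; apply: contraT; rewrite negb_exists_in => /forall_inP bigG.
  have: \sum_(v in G) (2 * i * d).+1 <= #|A| * d * i.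
    apply: (@leq_trans (\sum_(v in A) \sum_(x in U) #|agree A v x|)).
      apply: (@leq_trans (\sum_(v in G) \sum_(x in U) #|agree A v x|)).
        by apply: leq_sum => v Gv; rewrite ltnNge bigG.
      by rewrite [leqRHS](big_setID G) /= (setIidPr _) ?leq_addr ?subsetDl.
    rewrite exchange_big mulnC /i -sum_nat_const /=.
    by apply: leq_sum => x _; apply: sum_agree_le.
  by rewrite sum_nat_const; nia.
move: Gv; rewrite inE !in_setU !negb_or => /andP[/andP[/andP[vU vR] vC] Av].
have new x e : x \in U -> e \in pairs U -> c [set v; x] != c e.
  move=> Ux Ue; apply: contraNneq vR => cvx; apply/bigcupP; exists x => //.
  apply/bigcupP; exists (c e); first exact: imset_f.
  by rewrite inE Av -cvx setUC eqxx andbT; apply: contraNneq vU => ->.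
(* Two old edges differ by [rbU], an old and a new one by [new], and two new ones because [v] is not
   in [clashing A U]. *)
exists v; split=> // [e1 e2 /pairs_setU1[Ue1|[x Ux ->]]|].
- case/pairs_setU1=> [Ue2|[y Uy ->]]; first exact: rbU.
  by move/esym/eqP; rewrite (negPf (new _ _ _ _)).
- case/pairs_setU1=> [Ue2 /eqP|[y Uy -> /eqP cxy]].
    by rewrite (negPf (new _ _ _ _)).
  have [-> //|xy] := eqVneq x y.
  case/negP: vC; rewrite inE Av vU; apply/existsP; exists x; rewrite Ux.
  by apply/existsP; exists y; rewrite Uy xy.
(* The bound closes since i^2 d + 2 i d <= (i + 1)^2 d. *)
- have le1 := subset_leq_card (clashing_setU1 A U v).
  have [le2 _] := leq_card_setU (clashing A U) (\bigcup_(x in U) agree A v x).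
  have le3 := card_bigcup_le_sum U (agree A v).
  by nia.
Qed.

Lemma rainbow_of_bounded_degree s : 0 < d -> 2 * s ^ 3 * d <= #|A| ->
  exists2 U : {set T}, #|U| = s & {in pairs U &, injective c}.
Proof.
move=> d_gt0 leA.
(* The induction on [s] must also carry the inclusion in [A] and the clash bound, both of which the
   extension step consumes. *)
suff [U [_ Us rbU _]] : exists U : {set T}, [/\ U \subset A, #|U| = s,
    {in pairs U &, injective c} & #|clashing A U| <= s ^ 2 * d] by exists U.
elim: s leA => [|s IH] leA.
  exists set0; split; rewrite ?sub0set ?cards0 //.
    move=> e1 e2; rewrite inE subset0 => /andP[/eqP-> ].
    by rewrite cards0.
  rewrite leqn0 cards_eq0; apply/eqP/setP=> w; rewrite !inE.
  by apply/negP=> /andP[_ /existsP[x]]; rewrite inE.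
have [|U [UA Us rbU clU]] := IH.
  by apply: leq_trans leA; rewrite leq_mul2r leq_mul2l leq_exp2r // leqnSn !orbT.
rewrite -Us in clU leA.
have [v [Av vU rbv clv]] := rainbow_extend UA rbU clU d_gt0 leA.
by exists (v |: U); split; rewrite ?subUset ?sub1set ?Av -?Us ?cardsU1 ?vU.
Qed.

End BoundedDegree.

(** Here [f a] is the size still wanted in colour [a]. Separate targets allow induction on their
    sum: a descent in colour [a] lowers only [f a], by one. *)
Lemma rainbow_or_mono s (f : C -> nat) A (a0 : C) : 0 < s ->
    (2 * s ^ 3) ^ (\sum_a f a) <= #|A| ->
  (exists2 U : {set T}, #|U| = s & {in pairs U &, injective c}) \/
  (exists a (U : {set T}),
    [/\ U \subset A, #|U| = f a & {in pairs U, forall e, c e = a}]).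
Proof.
move=> s_gt0; have [m] := ubnP (\sum_a f a); elim: m f A => // m IH f A ltm leA.
(* A zero target is met by the empty set; otherwise all targets are positive and the truncated
   subtraction below is exact. *)
have [a /= fa0|fpos] := pickP [pred a | f a == 0].
  right; exists a, set0; rewrite sub0set cards0 (eqP fa0); split=> // e.
  by rewrite inE subset0 => /andP[/eqP->]; rewrite cards0.
have sumE a : \sum_b f b = (\sum_b (f b - (b == a))).+1.
  have fa := fpos a; rewrite /= in fa.
  rewrite (bigD1 a) // [in RHS](bigD1 a) //= eqxx.
  under [in RHS]eq_bigr => b /negPf-> do rewrite subn0.
  by lia.
pose d := (2 * s ^ 3) ^ (\sum_b f b).-1.
have d_gt0 : 0 < d by rewrite expn_gt0 muln_gt0 expn_gt0 s_gt0.
have [/exists_inP[x Ax /existsP[a dega]]|small] :=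
  boolP [exists x in A, exists a, d <= #|nbhd A x a|]; last first.
  left; apply: (@rainbow_of_bounded_degree A d) => // [x a Ax|].
    rewrite leqNgt; apply: contra small => /ltnW dega.
    by apply/exists_inP; exists x => //; apply/existsP; exists a.
  (* The colour [a0] shows that the sum is positive, so one factor [2 * s ^ 3] splits off. *)
  by move: leA; rewrite /d (sumE a0) expnS.
have [||?|[b [U [UN Ub mU]]]] := IH (fun b => f b - (b == a)) (nbhd A x a).
- by rewrite (sumE a) in ltm.
- by move: dega; rewrite /d (sumE a).
- by left.
right; have NA : nbhd A x a \subset A.
  by apply/subsetP=> y; rewrite inE => /andP[].
(* For [b] other than [a] the target was not lowered and [U] suffices; for [b] equal to [a], adding
   [x] makes up the missing vertex. *)
have [ba|ba] := eqVneq b a; last first.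
  by exists b, U; rewrite (subset_trans UN) // Ub (negPf ba) subn0.
subst b; exists a, (x |: U); split.
- by rewrite subUset sub1set Ax (subset_trans UN).
- have xU : x \notin U.
    by apply/negP=> /(subsetP UN); rewrite inE eqxx andbF.
  by rewrite cardsU1 xU Ub eqxx; have := fpos a; rewrite /=; lia.
- move=> e /pairs_setU1[/mU //|[y /(subsetP UN)]].
  by rewrite inE => /and3P[_ _ /eqP<-] ->.
Qed.

End Coloring.

Lemma complete_copy n s (U : {set 'I_n}) : #|U| = s ->
  exists2 f : complete s -> complete n, is_copy f &
    {subset copy_edges f <= pairs U}.
Proof.
move=> Us.
pose f (i : complete s) : complete n := enum_val (cast_ord (esym Us) i).
have f_inj : injective f by move=> i j /enum_val_inj /cast_ord_inj.
exists f; first by split=> // i j; rewrite /= (inj_eq f_inj).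
move=> _ /imsetP[_ /imsetP[[i j] /= ij ->] ->].
by rewrite imsetU !imset_set1 pairs_set2 ?enum_valP ?(inj_eq f_inj).
Qed.

Lemma gallai_ramsey_complete k s t : 0 < k -> 0 < s ->
  gallai_ramsey_prop k (complete s) (complete t) ((2 * s ^ 3) ^ (k * t)).
Proof.
move=> k_gt0 s_gt0 c.
have [||[U Us rbU]|[a [U [_ Ut mU]]]] :=
  @rainbow_or_mono _ _ c s (fun=> t) setT (Ordinal k_gt0).
- by [].
- by rewrite sum_nat_const cardsT !card_ord.
- left; have [f cf fU] := complete_copy Us; exists f => // e1 e2 /fU ? /fU ?.
  exact: rbU.
- right; have [f cf fU] := complete_copy Ut; exists f => // e1 e2 /fU ? /fU ?.
  by rewrite !mU.
Qed.

(** Well-ordering for an arbitrary, possibly undecidable [P], hence the use of excluded middle; it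
    turns an upper bound into an attained minimum. *)
Lemma ex_minimal (P : nat -> Prop) n : P n ->
  exists2 m, P m /\ (forall j, P j -> m <= j) & m <= n.
Proof.
elim/ltn_ind: n => n IH Pn.
have [[j [ltjn Pj]]|none] := classic (exists j, j < n /\ P j).
  have [m Pm le_mj] := IH j ltjn Pj.
  by exists m => //; rewrite (leq_trans le_mj) // ltnW.
exists n => //; split=> // j Pj; rewrite leqNgt; apply/negP=> ltjn.
by apply: none; exists j.
Qed.

Theorem corollary1p10 (k s t : nat) (hk : 0 < k) (hs : 0 < s) (ht : 47 <= t) :
  exists2 n : nat, is_gr k (complete s) (complete t) n &
    n <= 2 ^ (k * t) * s ^ (3 * k * t).
Proof.
have -> : 2 ^ (k * t) * s ^ (3 * k * t) = (2 * s ^ 3) ^ (k * t).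
  by rewrite expnMn -expnM mulnA.
exact: ex_minimal (@gallai_ramsey_complete k s t hk hs).
Qed.
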